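(* Let $n\geq 1$, let $f(t)\in\mathbb{Z}[t]$, $g(t)=t^n-1$ and let $\nu=\max\{d\mid f(t)\in\mathbb{Z}[t^d]\}$. Let $\rho$ be the rank and $\gamma_\rho$ the last non-zero determinantal divisor of the $n\times n$ circulant matrix associated with $f$. Then $n-\rho=1$ and $\gamma_\rho=1$ if and only if $\gcd(n,\nu)=1$ and one of the following holds: (a) $n$ is odd, $f(1)=0$, $(f(t),g(t))=t-1$, and $\mathrm{Res}\left(f(t)/(t-1),\sum_{i=0}^{n-1}t^i\right)=1$; (b) $n$ is even, $f(1)=0$, $|f(-1)|=2$, $(f(t),g(t))=t-1$, and $\mathrm{Res}\left(f(t)/(t-1),\sum_{i=0}^{n-1}t^i\right)=1$; (c) $n$ is even, $f(-1)=0$, $|f(1)|=2$, $(f(t),g(t))=t+1$, and $\mathrm{Res}\left(f(t)/(t+1),\sum_{i=0}^{n-1}(-t)^i\right)=1$ and $\mathrm{Res}(f(t),t^c-1)=2$ where $c$ is the largest odd divisor of $n$.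
   Context: For polynomials $p,q\in\mathbb{Z}[t]$, $(p(t),q(t))$ denotes their monic greatest common divisor and $\mathrm{Res}(p,q)$ denotes the absolute value of their resultant. The $n\times n$ circulant matrix associated with $f\in\mathbb{Z}[t]$ is the circulant matrix whose first row is $(a_0,\ldots,a_{n-1})$, where $f(t)=\sum_{i=0}^{n-1}a_it^i$ (for $f$ of degree at least $n$, the $a_i$ are the coefficients of the remainder of $f$ modulo $t^n-1$). If its Smith normal form is $\mathrm{diag}_n(s_1,\ldots,s_\rho,0,\ldots,0)$ with $\rho$ its rank, then the last non-zero determinantal divisor is $\gamma_\rho=\prod_{i=1}^\rho s_i$, taken positive (equal to $1$ if $\rho=0$). *)

(* Defs.v *)
From HB Require Import structures.
From mathcomp Require Import all_boot all_order all_algebra.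

Set Implicit Arguments.
Unset Strict Implicit.
Unset Printing Implicit Defensive.

Import Order.TTheory GRing.Theory Num.Theory.
Local Open Scope ring_scope.

(* f \in Z[t^d]; see in_ZXnP. *)
Definition in_ZXn (d : nat) (f : {poly int}) : bool :=
  [forall i : 'I_(size f), (f`_i != 0) ==> (d %| i)%N].

Lemma in_ZXnP d (f : {poly int}) :
  reflect (exists h : {poly int}, f = h \Po 'X^d) (in_ZXn d f).
Proof.
apply: (iffP forallP) => [fd|[h ->] i].
  case: (posnP d) => [d0|d_gt0].
    exists f; rewrite d0 expr0 -[1]/(1%:P) comp_polyCr.
    have f0 i : (0 < i)%N -> f`_i = 0.
      move=> i0; case: (ltnP i (size f)) => [lif|]; last exact: nth_default.
      have := fd (Ordinal lif); rewrite /= d0 dvd0n; apply: contraTeq => nz.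
      by rewrite nz -lt0n i0.
    suff fC : f = (f`_0)%:P by rewrite {2}fC hornerC.
    by apply: size1_polyC; apply/leq_sizeP => j; apply: f0.
  exists (\poly_(i < size f) f`_(i * d)); apply/polyP => i.
  rewrite coef_comp_poly_Xn // coef_poly.
  case: ifPn => [di|ndi].
    rewrite divnK //; case: ltnP => // le; apply: nth_default.
    exact: leq_trans le (leq_div _ _).
  case: (ltnP i (size f)) => [lif|]; last exact: nth_default.
  by have := fd (Ordinal lif); rewrite /= (negPf ndi) implybF negbK => /eqP.
apply/implyP; move: (nat_of_ord i) => k; case: (posnP d) => [->|d_gt0].
  rewrite expr0 -[1]/(1%:P) comp_polyCr coefC dvd0n.
  by case: ifP => //; rewrite eqxx.
by rewrite coef_comp_poly_Xn //; case: ifP => //; rewrite eqxx.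
Qed.

(* max {d | f \in Z[t^d]}. For non-constant f every such d is at most deg f,
   whence the range (see nu_maxP). For constant f the set is unbounded and the
   value here is 0, so that gcdn n (nu f) = n. *)
Definition nu (f : {poly int}) : nat := (\max_(d < size f | in_ZXn d f) d)%N.

Lemma nu_maxP (f : {poly int}) : (1 < size f)%N ->
  in_ZXn (nu f) f /\ (forall d, in_ZXn d f -> (d <= nu f)%N).
Proof.
move=> f_nc; have f1 : in_ZXn 1 f by apply/forallP => i; rewrite dvd1n implybT.
split.
  have [|d df nuE] :=
    @eq_bigmax_cond _ [pred d : 'I_(size f) | in_ZXn d f] (@nat_of_ord _).
    by apply/card_gt0P; exists (Ordinal f_nc).
  by have -> : nu f = d by [].
move=> d df; have ld : (d < size f)%N.
  have lt : ((size f).-1 < size f)%N by rewrite prednK // ltnW.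
  have nz : f`_(size f).-1 != 0.
    by rewrite -lead_coefE lead_coef_eq0 -size_poly_gt0 ltnW.
  have := forallP df (Ordinal lt); rewrite /= nz /= => /dvdn_leq le.
  by apply: leq_ltn_trans lt; apply: le; rewrite -subn1 subn_gt0.
exact: (@leq_bigmax_cond _ _ (fun d : 'I_(size f) => val d) (Ordinal ld)).
Qed.

(* Row i + 1 is row i shifted cyclically one step to the right; the first row
   is (a_0, ..., a_(n-1)), the coefficients of f modulo t^n - 1. *)
Definition circulant (n : nat) (f : {poly int}) : 'M[int]_n :=
  \matrix_(i, j) (f %% ('X^n - 1))`_((j + (n - i)) %% n).

Definition int_rank (n : nat) (A : 'M[int]_n) : nat :=
  \rank (map_mx (intr : int -> rat) A).

(* diag(s) is a Smith normal form of A. The s_i are determined up to sign. *)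
Definition smith_form (n : nat) (A : 'M[int]_n) (s : 'rV[int]_n) : Prop :=
  (forall i j : 'I_n, (i <= j)%N -> (s 0%R i %| s 0%R j)%Z) /\
  exists L R : 'M[int]_n,
    [/\ L \in unitmx, R \in unitmx & A = L *m diag_mx s *m R].

Lemma smith_form_exists (n : nat) (A : 'M[int]_n) : exists s, smith_form A s.
Proof.
have [L Lu [R Ru [d ds ->]]] := int_Smith_normal_form A.
exists (\row_i d`_i); split=> [i j le_ij|].
  rewrite !mxE; case: (ltnP j (size d)) => [ltj|lej]; last first.
    by rewrite (nth_default _ lej) dvdz0.
  have dtr : transitive dvdz by move=> y x z; apply: dvdz_trans.
  by apply: (sorted_leq_nth dtr dvdzz) => //; rewrite inE // (leq_ltn_trans le_ij).
exists L, R; split=> //; congr (_ *m _ *m _).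
by apply/matrixP => i j; rewrite !mxE.
Qed.

(* gamma = s_1 ... s_rho > 0, where rho is the rank of A. *)
Definition last_det_divisor (n : nat) (A : 'M[int]_n) (gamma : nat) : Prop :=
  exists2 s : 'rV[int]_n, smith_form A s &
    gamma = (\prod_(i < n | (i < int_rank A)%N) `|s 0%R i|)%N.

(* Computed over Q, where a monic gcd always exists (unless p = q = 0). If p or
   q is monic, it has integer coefficients and is the monic gcd in Z[t]. *)
Definition monic_gcd (p q : {poly int}) : {poly rat} :=
  let d := gcdp (map_poly (intr : int -> rat) p)
                (map_poly (intr : int -> rat) q) in
  (lead_coef d)^-1 *: d.

Definition Res (p q : {poly int}) : nat := `|resultant p q|%N.

Definition largest_odd_divisor (n : nat) : nat :=
  (\max_(d <- divisors n | odd d) d)%N.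

(* Main.v *)
(* The circulant matrix of f is multiplication by f on Z[t]/(t^n - 1). If z is a
   common divisor of f = z f1 and t^n - 1 = +-z h, this map factors as the
   projection onto Z[t]/(h), multiplication by f1 there, and multiplication by z
   back into Z[t]/(t^n - 1); the outer two maps are split over Z. Over Q, with z
   the gcd, this gives n - rho = deg z. Over Z, with deg z = 1 and rho = n - 1, it
   gives gamma = |det(f1 on Z[t]/(h))| = Res(f1, h). If n - rho = 1, then
   z = t - a with a = 1 or a = -1, since a is a rational root of unity. The other
   conditions are consequences: when Res(f1, h) = 1, f1 is invertible modulo h,
   hence takes unit values at the roots of h and has resultant 1 with any divisor
   of h; and f in Z[t^d] with d | n would force t^d - a^d to divide z. *)
Require Import Defs.
From HB Require Import structures.
From mathcomp Require Import all_boot all_order all_algebra ring.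

Set Implicit Arguments.
Unset Strict Implicit.
Unset Printing Implicit Defensive.

Import Order.TTheory GRing.Theory Num.Theory.
Local Open Scope ring_scope.

Import Pdiv.IdomainUnit.

(** * Multiplication modulo a polynomial as a matrix *)

Section PolyMaps.

Variable R : idomainType.
Implicit Types (p q u v w z h : {poly R}) (phi psi : {poly R} -> {poly R}).

(* The matrix, acting on row vectors, of a map from polynomials of degree < m
   to polynomials of degree < n, in the monomial bases. *)
Definition poly_map_mx m n phi : 'M[R]_(m, n) :=
  \matrix_(i < m, j < n) (phi 'X^i)`_j.

Lemma eq_poly_map_mx m n phi psi :
  (forall i, (i < m)%N -> phi 'X^i = psi 'X^i) ->
  poly_map_mx m n phi = poly_map_mx m n psi.
Proof. by move=> e; apply/matrixP=> i j; rewrite !mxE e. Qed.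

Lemma poly_map_mx_id m : poly_map_mx m m id = 1%:M.
Proof. by apply/matrixP=> i j; rewrite !mxE coefXn eq_sym. Qed.

Lemma mul_poly_map_mx m n phi (u : 'rV_m) : linear phi ->
  u *m poly_map_mx m n phi = poly_rV (phi (rVpoly u)).
Proof.
move=> lin_phi.
pose phiL := GRing.isLinear.Build R {poly R} {poly R} *:%R phi lin_phi.
pose L : {linear {poly R} -> {poly R}} := HB.pack phi phiL.
have -> : poly_map_mx m n phi = lin1_mx (poly_rV \o L \o rVpoly).
  by apply/matrixP=> i j; rewrite !mxE /= rVpoly_delta.
by rewrite mul_rV_lin1.
Qed.

(** The size bound ensures that truncation below degree [n] loses nothing; row vectors reverse the
    order of the factors. *)
Lemma poly_map_mx_comp m n k phi psi : linear psi ->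
  (forall i, (i < m)%N -> (size (phi 'X^i) <= n)%N) ->
  poly_map_mx m n phi *m poly_map_mx n k psi = poly_map_mx m k (psi \o phi).
Proof.
move=> lin_psi sz_phi; apply/row_matrixP=> i; rewrite row_mul.
have -> : row i (poly_map_mx m n phi) = poly_rV (phi 'X^i).
  by apply/rowP=> j; rewrite !mxE.
rewrite mul_poly_map_mx // poly_rV_K ?sz_phi //.
by apply/rowP=> j; rewrite !mxE.
Qed.

Lemma linear_mulmod p q : lead_coef q \is a GRing.unit ->
  linear (fun x => (p * x) %% q).
Proof. by move=> uq c x y; rewrite mulrDr -scalerAr modpD // modpZl. Qed.

Lemma linear_divp q : lead_coef q \is a GRing.unit -> linear (fun x => x %/ q).
Proof. by move=> uq c x y; rewrite divpD // divpZl. Qed.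

Lemma linear_mul p : linear (fun x => p * x).
Proof. by move=> c x y; rewrite mulrDr -scalerAr. Qed.

Lemma unit_lead_neq0 q : lead_coef q \is a GRing.unit -> q != 0.
Proof. by apply: contraTneq => ->; rewrite lead_coef0 unitr0. Qed.

Lemma size_modp_le d p q : size q = d.+1 -> (size (p %% q)%R <= d)%N.
Proof. by move=> sq; rewrite -ltnS -sq ltn_modp -size_poly_gt0 sq. Qed.

Definition mulmod_mx d p q : 'M[R]_d :=
  poly_map_mx d d (fun x => (p * x) %% q).

Lemma mulmod_mxM d p1 p2 q : lead_coef q \is a GRing.unit -> size q = d.+1 ->
  mulmod_mx d p2 q *m mulmod_mx d p1 q = mulmod_mx d (p1 * p2) q.
Proof.
move=> uq sq; rewrite poly_map_mx_comp; first last.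
- by move=> i _; apply: size_modp_le.
- exact: linear_mulmod.
by apply: eq_poly_map_mx => i _ /=; rewrite modp_mul // mulrA.
Qed.

Lemma mulmod_mx1 d q : size q = d.+1 -> mulmod_mx d 1 q = 1%:M.
Proof.
move=> sq; rewrite -poly_map_mx_id; apply: eq_poly_map_mx => i lid.
by rewrite mul1r modp_small // size_polyXn sq.
Qed.

(** The inverse is multiplication by [u]. *)
Lemma mulmod_mx_unit d p q u v : lead_coef q \is a GRing.unit ->
  size q = d.+1 -> u * p + v * q = 1 -> mulmod_mx d p q \in unitmx.
Proof.
move=> uq sq uv1.
suff /mulmx1_unit[] : mulmod_mx d p q *m mulmod_mx d u q = 1%:M.
  by [].
rewrite mulmod_mxM // -(mulmod_mx1 sq); apply: eq_poly_map_mx => i _.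
have -> : u * p = 1 - v * q by rewrite -uv1 addrK.
rewrite mulrBl modpD // mulrAC -mulNr.
rewrite -[_ * q]addr0 modp_addl_mul_small ?size_poly0 ?addr0 //.
by rewrite size_poly_gt0 unit_lead_neq0.
Qed.

(** The row of the inverse matrix at the basis vector 1 gives [w] with p w = 1 modulo [q]. *)
Lemma bezout_of_mulmod_mx_unit d p q : lead_coef q \is a GRing.unit ->
  size q = d.+1 -> mulmod_mx d p q \in unitmx ->
  exists u v, u * p + v * q = 1.
Proof.
case: d => [|d] uq sq uM.
  (* For d = 0 the quotient ring is zero and has no basis vector 1, but [q] is then a unit
     constant. *)
  have q1 : q = (lead_coef q)%:P.
    by rewrite [LHS]size1_polyC ?sq // lead_coefE sq.
  exists 0, ((lead_coef q)^-1)%:P.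
  by rewrite mul0r add0r [in X in _ * X]q1 -polyCM mulVr.
pose w := rVpoly (delta_mx 0 0 *m invmx (mulmod_mx d.+1 p q)).
have lin := linear_mulmod p uq.
have := mul_poly_map_mx d.+1 (delta_mx 0 0 *m invmx (mulmod_mx d.+1 p q)) lin.
rewrite mulmxKV // -/w => /(congr1 rVpoly).
rewrite rVpoly_delta poly_rV_K ?size_modp_le // expr0 => e.
exists w, (- ((p * w) %/ q)).
by rewrite [w * p]mulrC {1}(divp_eq uq (p * w)) -e mulNr addrAC subrr add0r.
Qed.

(* Multiplication by [z * f1] on [R[X]/(z * h)] factors as the projection onto
   [R[X]/(h)], multiplication by [f1] there, and multiplication by [z]. *)
Lemma mulmod_mx_factor k m z h f1 :
  lead_coef z \is a GRing.unit -> size z = k.+1 ->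
  lead_coef h \is a GRing.unit -> size h = m.+1 ->
  exists (P : 'M_(k + m, m)) (Q : 'M_(m, k + m)) (E : 'M_(m, k + m))
    (E' : 'M_(k + m, m)),
    [/\ mulmod_mx (k + m) (z * f1) (z * h) = P *m mulmod_mx m f1 h *m Q,
        E *m P = 1%:M & Q *m E' = 1%:M].
Proof.
move=> uz sz uh sh; have [z0 h0] := (unit_lead_neq0 uz, unit_lead_neq0 uh).
have uzh : lead_coef (z * h) \is a GRing.unit by rewrite lead_coefM unitrM uz uh.
exists (poly_map_mx _ _ (fun x => x %% h)), (poly_map_mx _ _ (fun x => z * x)),
  (poly_map_mx _ _ id), (poly_map_mx _ _ (fun x => x %/ z)); split.
- rewrite poly_map_mx_comp; first last.
  + by move=> i _; apply: size_modp_le.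
  + exact: linear_mulmod.
  rewrite poly_map_mx_comp; first last.
  + by move=> i _; apply: size_modp_le.
  + exact: linear_mul.
  apply: eq_poly_map_mx => i _ /=; rewrite modp_mul //.
  (* Multiplying the division of f1 X^i by [h] through by [z] gives the division by z h. *)
  apply/esym; apply: (@modpP _ _ uzh _ ((f1 * 'X^i) %/ h)).
    by rewrite mulrCA -mulrDr -divp_eq // mulrA.
  have [->|r0] := eqVneq ((f1 * 'X^i) %% h) 0.
    by rewrite mulr0 size_poly0 size_poly_gt0 mulf_neq0.
  by rewrite !size_mul // sz !addSn /= ltn_add2l ltn_modp.
- rewrite poly_map_mx_comp; first last.
  + by move=> i li; rewrite size_polyXn ltn_addl.
  + by move=> c x y; rewrite modpD // modpZl.
  rewrite -poly_map_mx_id; apply: eq_poly_map_mx => i li /=.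
  by rewrite modp_small // size_polyXn sh.
rewrite poly_map_mx_comp; first last.
- move=> i li; rewrite size_mul // ?monic_neq0 ?monicXn //.
  by rewrite sz size_polyXn addSn /= leq_add2l.
- exact: linear_divp.
rewrite -poly_map_mx_id; apply: eq_poly_map_mx => i li /=.
by rewrite mulKp.
Qed.

(** Dividing the Sylvester rows X^i p by [q] leaves the remainders, since the quotients contribute
    combinations of the rows X^j q. The result is block triangular, with multiplication by [p] as
    one diagonal block. *)
Lemma resultant_mulmod_mx d p q : lead_coef q \is a GRing.unit ->
  size q = d.+1 ->
  resultant p q = \det (mulmod_mx d p q) * lead_coef q ^+ (size p).-1.
Proof.
move=> uq sq; have -> : d = (size q).-1 by rewrite sq.
have q0 := unit_lead_neq0 uq.
set dq := (size q).-1; set dp := (size p).-1.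
have sqE : size q = dq.+1 by rewrite /dq prednK // size_poly_gt0.
pose D : 'M_(dq, dp) := poly_map_mx dq dp (fun x => (p * x) %/ q).
pose S1 : 'M_(dq, dq + dp) := poly_map_mx dq (dq + dp) (fun x => p * x).
pose S2 : 'M_(dp, dq + dp) := poly_map_mx dp (dq + dp) (fun x => q * x).
have SE : Sylvester_mx p q = col_mx S1 S2.
  by congr col_mx; apply/matrixP=> i j; rewrite !mxE /= rVpoly_delta mulrC.
have S1E : S1 = row_mx (mulmod_mx dq p q) 0 + D *m S2.
  rewrite poly_map_mx_comp; first last.
  - move=> i li; rewrite size_divp // -/dq leq_subLR.
    have [->|p0] := eqVneq p 0; first by rewrite mul0r size_poly0.
    rewrite size_mul // ?monic_neq0 ?monicXn // size_polyXn addnS /=.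
    rewrite [size p]polySpred // -/dp addSn -addnS addnC.
    by rewrite leq_add2r.
  - exact: linear_mul.
  apply/matrixP=> i j; rewrite !mxE /=.
  rewrite {1}(divp_eq uq (p * 'X^i)) coefD addrC [q * _]mulrC; congr (_ + _).
  case: splitP => k jk; rewrite !mxE jk //.
  by rewrite nth_default // (leq_trans (size_modp_le _ sqE)) // leq_addr.
(* In these columns X^i q has its leading term in column [i], so the block is lower triangular. *)
have S2E : rsubmx S2 = \matrix_(i, j) ('X^i * q)`_(dq + j).
  by apply/matrixP=> i j; rewrite !mxE mulrC.
have detS2 : \det (rsubmx S2) = lead_coef q ^+ dp.
  have trigS2 : is_trig_mx (rsubmx S2).
    apply/is_trig_mxP=> i j lij; rewrite S2E mxE coefXnM.
    case: ifP => // _; rewrite nth_default // sqE -addnBA ?(ltnW lij) //.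
    by rewrite -addn1 leq_add2l subn_gt0.
  rewrite det_trig // (eq_bigr (fun=> lead_coef q)) => [|i _].
    by rewrite prodr_const card_ord.
  by rewrite S2E mxE coefXnM ltnNge leq_addl /= addnK.
rewrite /resultant SE S1E.
have -> : col_mx (row_mx (mulmod_mx dq p q) 0 + D *m S2) S2 =
    block_mx 1%:M D 0 1%:M *m
    block_mx (mulmod_mx dq p q) 0 (lsubmx S2) (rsubmx S2).
  rewrite mulmx_block !mul1mx !mul0mx !add0r.
  rewrite -{1 2}[S2]hsubmxK mul_mx_row add_row_mx /block_mx add0r.
  by [].
by rewrite det_mulmx det_ublock !det1 !mul1r det_lblock detS2.
Qed.

(** Multiplication by X modulo [q] is the companion matrix, whose characteristic polynomial [q] is
    then evaluated at [a]. *)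
Lemma det_mulmod_XsubC d a q : q \is monic -> size q = d.+1 -> (0 < d)%N ->
  \det (mulmod_mx d ('X - a%:P) q) = (-1) ^+ d * q.[a].
Proof.
move=> mq sq; have -> : d = (size q).-1 by rewrite sq.
set dq := (size q).-1 => dq0; have sqE : size q = dq.+1 by rewrite /dq sq.
have uq : lead_coef q \is a GRing.unit by rewrite (monicP mq) unitr1.
have -> : mulmod_mx dq ('X - a%:P) q = - (a%:M - companionmx q).
  apply/matrixP=> i j; rewrite !mxE.
  rewrite mulrBl -exprS modpD // -mulNr -[- a%:P]polyCN mul_polyC modpZl //.
  rewrite [('X^i) %% q]modp_small ?size_polyXn ?sqE ?ltnS ?ltn_ord //.
  rewrite coefD coefZ coefXn opprB mulNr mulr_natr [j == i :> nat]eq_sym.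
  congr (_ - _).
  case: ifP => [/eqP iE|ine].
    (* Last row: as [q] is monic, X^dq reduces to X^dq - q. *)
    have -> : i.+1 = dq by rewrite iE prednK.
    have <- : 'X^dq - q = 'X^dq %% q.
      apply: (@modpP _ _ uq _ 1); first by rewrite mul1r addrC subrK.
      rewrite sqE ltnS; apply/leq_sizeP => k; rewrite leq_eqVlt => /predU1P[<-|lk].
        rewrite coefB coefXn eqxx.
        by move/monicP: mq; rewrite lead_coefE -/dq => ->; rewrite subrr.
      by rewrite coefB coefXn gtn_eqF // sub0r nth_default ?oppr0 // sqE.
    by rewrite coefB coefXn ltn_eqF ?sub0r.
  have li : (i.+1 < dq)%N.
    rewrite ltn_neqAle ltn_ord andbT; apply: contraFneq ine => e.
    by rewrite -eqSS e [X in _ == X]prednK.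
  by rewrite modp_small ?size_polyXn ?sqE // coefXn eq_sym.
rewrite -scaleN1r detZ; congr (_ * _).
rewrite -[q in RHS](companionmxK mq) /char_poly -horner_evalE -det_map_mx.
congr (\det _); apply/matrixP=> i j.
by rewrite !mxE /= /horner_eval hornerD hornerN hornerC hornerMn hornerX.
Qed.

End PolyMaps.

(** * Circulants, ranks and Smith forms under split factorizations *)

(** A cyclic shift is multiplication by X modulo X^n - 1, so row [i] holds the coefficients of X^i
    f. *)
Lemma circulantE n f : (0 < n)%N -> circulant n f = mulmod_mx n f ('X^n - 1).
Proof.
move=> n0; set g := 'X^n - 1.
have sg : size g = n.+1 by rewrite size_Xn_sub_1.
have ug : lead_coef g \is a GRing.unit.
  by rewrite (monicP (monicXnsubC 1 n0)) unitr1.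
apply/matrixP=> i j; rewrite !mxE mulrC -modp_mul // mulrC.
set a := f %% g; have sa : (size a <= n)%N by apply: size_modp_le.
have lin := ltn_ord i; have ljn := ltn_ord j.
set k := (n - i)%N; have ik : (i + k)%N = n by rewrite subnKC // ltnW.
(* The coefficients of degree at least k = n - i wrap around to the bottom; they also form the
   quotient by X^n - 1. *)
have <- : take_poly k a * 'X^i + drop_poly k a = (a * 'X^i) %% g.
  apply: (@modpP _ _ ug _ (drop_poly k a)).
    rewrite -{1}[a](poly_take_drop k) mulrDl -mulrA -exprD [(k + i)%N]addnC ik.
    by rewrite mulrBr mulr1 addrACA addNr addr0 addrC.
  rewrite sg ltnS (leq_trans (size_polyD _ _)) // geq_max size_drop_poly.
  rewrite (leq_trans (leq_subr _ _)) // andbT.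
  apply/leq_sizeP => m lem; rewrite coefMXn coef_take_poly.
  case: ltnP => // leim; case: ifP => //.
  by rewrite ltn_subLR // ik ltnNge lem.
rewrite coefD coefMXn coef_take_poly coef_drop_poly.
have [lji|lij] := ltnP j i.
  by rewrite add0r modn_small // -[X in (_ < X)%N]ik ltn_add2r.
have -> : (j - i < k)%N by rewrite ltn_sub2r // ltn_sub2r.
rewrite [a`_(j + k)]nth_default ?addr0; last first.
  by rewrite (leq_trans sa) // -[X in (X <= _)%N]ik leq_add2r.
rewrite -[X in (X + k)%N](subnK lij) -addnA ik modnDr modn_small //.
by rewrite (leq_ltn_trans (leq_subr _ _)).
Qed.

(** [E] and [E'] recover [B] from the product, so neither rank exceeds the other. *)
Lemma rank_factor (F : fieldType) n m (P : 'M[F]_(n, m)) B Q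
    (E : 'M_(m, n)) (E' : 'M_(n, m)) :
  E *m P = 1%:M -> Q *m E' = 1%:M -> \rank (P *m B *m Q) = \rank B.
Proof.
move=> EP QE'; apply/eqP; rewrite eqn_leq; apply/andP; split.
  by rewrite (leq_trans (mxrankM_maxl _ _)) // mxrankM_maxr.
have {1}-> : B = E *m (P *m B *m Q) *m E'.
  by rewrite !mulmxA EP mul1mx -mulmxA QE' mulmx1.
by rewrite (leq_trans (mxrankM_maxl _ _)) // mxrankM_maxr.
Qed.

Lemma int_rank_factor n m (P : 'M[int]_(n, m)) B Q
    (E : 'M_(m, n)) (E' : 'M_(n, m)) :
  E *m P = 1%:M -> Q *m E' = 1%:M -> int_rank (P *m B *m Q) = int_rank B.
Proof.
move=> EP QE'; rewrite /int_rank !map_mxM /=.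
apply: (@rank_factor _ _ _ _ _ _ (map_mx intr E) (map_mx intr E')).
  by rewrite -map_mxM EP map_mx1.
by rewrite -map_mxM QE' map_mx1.
Qed.

Lemma int_rank_full n (B : 'M[int]_n) : (int_rank B == n) = (\det B != 0).
Proof.
rewrite /int_rank -/(row_free _) row_free_unit unitmxE det_map_mx.
by rewrite unitfE intr_eq0.
Qed.

(** The Smith form, whose last entry is zero, gives a second split factorization of [A], through
    diag(s_1, ..., s_m), to be compared with the one through [B]. *)
Lemma last_det_divisor_factor m (A : 'M[int]_m.+1) (P : 'M_(m.+1, m)) B Q
    (E : 'M_(m, m.+1)) (E' : 'M_(m.+1, m)) gamma :
  A = P *m B *m Q -> E *m P = 1%:M -> Q *m E' = 1%:M ->
  int_rank A = m -> last_det_divisor A gamma -> gamma = `|\det B|%N.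
Proof.
move=> defA EP QE' rkA [s [ds [L [R [uL uR defD]]]] ->]; rewrite rkA.
have detA0 : \det A == 0.
  by rewrite -[_ == 0]negbK -int_rank_full rkA ltn_eqF.
(* Since [A] is singular some s_i vanishes, and divisibility carries the zero to the last entry. *)
have s0 : s 0 ord_max = 0.
  have : \det (diag_mx s) == 0.
    move: detA0; rewrite defD !det_mulmx !mulf_eq0.
    have nz C : C \in unitmx -> (\det C == 0 :> int) = false.
      by rewrite unitmxE; apply: contraTF => /eqP ->; rewrite unitr0.
    by rewrite (nz _ L) // (nz _ R) // orbF.
  rewrite det_diag => /prodf_eq0[i _ /eqP si].
  by have := ds i ord_max (leq_ord i); rewrite si dvd0z => /eqP.
pose s' : 'rV[int]_m := \row_i s 0 (widen_ord (leqnSn m) i).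
have prodE : (\prod_(i < m.+1 | (i < m)%N) `|s 0%R i|)%N =
    `|\det (diag_mx s')|%N.
  rewrite big_mkcond big_ord_recr /= ltnn muln1 det_diag.
  under eq_bigr do rewrite ltn_ord.
  under [in RHS]eq_bigr do rewrite mxE.
  by rewrite (big_morph _ abszM (erefl _)).
(* On row vectors, [W] drops the last coordinate and [W'] appends a zero. *)
pose W : 'M[int]_(m.+1, m) := pid_mx m; pose W' : 'M[int]_(m, m.+1) := pid_mx m.
have W'W : W' *m W = 1%:M by rewrite pid_mx_id ?pid_mx_1.
have DE : diag_mx s = W *m diag_mx s' *m W'.
  have sW i j : s 0 i * (W i j) = W i j * s' 0 j.
    rewrite !mxE; case: andP => [[/eqP ij _]|_]; last by rewrite mulr0 mul0r.
    by rewrite mulrC; congr (_ * s 0 _); apply: val_inj.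
  have -> : W *m diag_mx s' = diag_mx s *m W.
    by apply/matrixP=> i j; rewrite mul_mx_diag mul_diag_mx [LHS]mxE [RHS]mxE sW.
  rewrite -mulmxA pid_mx_id ?leqnn // mul_diag_mx.
  apply/matrixP=> i j; rewrite !mxE.
  case: (ltnP i m) => lim; rewrite ?andbT ?andbF ?mulr_natr ?mulr0n //.
  have -> : i = ord_max by apply/val_inj/eqP; rewrite eqn_leq lim -ltnS ltn_ord.
  by rewrite s0 mul0rn.
have D'E : diag_mx s' = W' *m diag_mx s *m W.
  by rewrite DE !mulmxA W'W mul1mx -!mulmxA W'W mulmx1.
(* Each of [\det B] and [s_1 ... s_m] divides the other. *)
have detB : \det B =
    \det (E *m L *m W) * \det (diag_mx s') * \det (W' *m R *m E').
  rewrite -!det_mulmx; congr (\det _).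
  transitivity (E *m A *m E').
    by rewrite defA !mulmxA EP mul1mx -mulmxA QE' mulmx1.
  by rewrite defD DE !mulmxA.
have detD' : \det (diag_mx s') =
    \det (W' *m invmx L *m P) * \det B * \det (Q *m invmx R *m W).
  rewrite -!det_mulmx; congr (\det _).
  have -> : diag_mx s' = W' *m (invmx L *m A *m invmx R) *m W.
    by rewrite D'E defD !mulmxA mulmxKV // mulmxK.
  by rewrite defA !mulmxA.
rewrite prodE; apply/eqP; rewrite eqn_dvd; apply/andP; split.
  by rewrite -dvdzE detB mulrAC dvdz_mull.
by rewrite -dvdzE detD' mulrAC dvdz_mull.
Qed.

Lemma unitz_absz (x : int) : (x \is a GRing.unit) = (`|x|%N == 1%N).
Proof.
by apply/idP/idP=> [/orP[]/eqP-> //|]; case: x => [[|[|k]]|[|k]].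
Qed.

Lemma unit_lead_Xn_sub_1 (R : idomainType) n : (0 < n)%N ->
  lead_coef ('X^n - 1 : {poly R}) \is a GRing.unit.
Proof. by move=> n0; rewrite (monicP (monicXnsubC 1 n0)) unitr1. Qed.

(** The power of the leading coefficient in [resultant_mulmod_mx] is 1 or -1. *)
Lemma absz_Res (p q : {poly int}) : lead_coef q \is a GRing.unit ->
  Res p q = `|\det (mulmod_mx (size q).-1 p q)|%N.
Proof.
move=> uq; have sq : size q = (size q).-1.+1.
  by rewrite prednK // size_poly_gt0 unit_lead_neq0.
rewrite /Res (resultant_mulmod_mx _ uq sq) abszM.
by have := unitrX (size p).-1 uq; rewrite unitz_absz => /eqP->; rewrite muln1.
Qed.

(** As [z] is linear, the matrix of [f1] on Z[t]/(h) has size n - 1 and the rank of the circulant;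
    when the corank is 1, [gamma] is its determinant up to sign. The unit [e] absorbs the sign in (t
    + 1) h = -(t^n - 1). *)
Lemma corank1_gammaP n (f z h f1 : {poly int}) (e : int) gamma : (0 < n)%N ->
  size z = 2 -> e \is a GRing.unit -> z * h = e *: ('X^n - 1) -> f = z * f1 ->
  last_det_divisor (circulant n f) gamma ->
  ((n - int_rank (circulant n f))%N = 1%N /\ gamma = 1%N) <-> Res f1 h = 1%N.
Proof.
case: n => // m _ sz ue zhE fE; set g := 'X^(m.+1) - 1 in zhE *.
have ug : lead_coef g \is a GRing.unit by apply: unit_lead_Xn_sub_1.
have sg : size g = m.+2 by rewrite size_Xn_sub_1.
have e0 : e != 0 by apply: contraTneq ue => ->; rewrite unitr0.
have /andP[uz uh] :
    (lead_coef z \is a GRing.unit) && (lead_coef h \is a GRing.unit).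
  by rewrite -unitrM -lead_coefM zhE lead_coefZ unitrM ue.
have sh : size h = m.+1.
  have := congr1 (size : {poly int} -> nat) zhE.
  by rewrite size_mul ?unit_lead_neq0 // sz size_scale // sg => -[].
rewrite circulantE // -/g.
have [P [Q [E [E' [defA EP QE']]]]] := mulmod_mx_factor f1 uz sz uh sh.
have {}defA : mulmod_mx m.+1 f g = P *m mulmod_mx m f1 h *m Q.
  rewrite -defA -fE zhE; apply: eq_poly_map_mx => i _.
  by rewrite modpZr.
have rkA : int_rank (mulmod_mx m.+1 f g) = int_rank (mulmod_mx m f1 h).
  by rewrite defA (int_rank_factor _ EP QE').
move=> lastA; rewrite absz_Res // sh /=.
have gammaE : int_rank (mulmod_mx m.+1 f g) = m ->
    gamma = `|\det (mulmod_mx m f1 h)|%N.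
  by move=> rk; apply: last_det_divisor_factor defA EP QE' rk lastA.
split=> [[rk1 gamma1]|det1].
  rewrite -gammaE //; have := rk1; rewrite rkA.
  have le_m : (int_rank (mulmod_mx m f1 h) <= m)%N by apply: rank_leq_row.
  rewrite subSn // => -[/eqP]; rewrite subn_eq0 => ge_m.
  by apply/eqP; rewrite eqn_leq le_m ge_m.
have rk : int_rank (mulmod_mx m.+1 f g) = m.
  by apply/eqP; rewrite rkA int_rank_full -absz_eq0 det1.
by rewrite gammaE // rk subSnn.
Qed.

(** * The corank over the rationals *)

(** With a unit leading coefficient, division over Z stays a valid division over Q, where the
    remainder is unique. *)
Lemma map_mulmod_mx d (p q : {poly int}) :
  lead_coef q \is a GRing.unit -> size q = d.+1 ->
  map_mx (intr : int -> rat) (mulmod_mx d p q) =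
  mulmod_mx d (map_poly intr p) (map_poly intr q).
Proof.
move=> uq sq; apply/matrixP=> i j; rewrite !mxE -coef_map /=.
congr ((polyseq _)`_j); set x := p * _.
have -> : map_poly intr p * 'X^i = map_poly intr x :> {poly rat}.
  by rewrite rmorphM /= map_polyXn.

have e : map_poly intr x = map_poly intr (x %/ q) * map_poly intr q
    + map_poly intr (x %% q) :> {poly rat}.
  by rewrite -rmorphM -rmorphD /= -divp_eq.
apply: Pdiv.Field.modpP e _.
by rewrite !(size_map_inj_poly (@intr_inj rat)) ?rmorph0 // ltn_modp unit_lead_neq0.
Qed.

Local Notation pQ := (map_poly (intr : int -> rat)).

(** Divided by the gcd [z], the cofactors [f1] and [h] are coprime, so [f1] acts invertibly on
    Q[t]/(h) and the rank is deg h = n - deg z. *)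
Lemma corank_gcd n f : (0 < n)%N ->
  (n - int_rank (circulant n f))%N = (size (gcdp (pQ f) (pQ ('X^n - 1)))).-1.
Proof.
move=> n0; have ug := unit_lead_Xn_sub_1 int n0.
have sg : size ('X^n - 1 : {poly int}) = n.+1 by rewrite size_Xn_sub_1.
rewrite circulantE // /int_rank map_mulmod_mx //.
have {ug sg} : size (pQ ('X^n - 1)) = n.+1.
  by rewrite rmorphB rmorph1 /= map_polyXn size_Xn_sub_1.
move: (pQ f) (pQ _) => {}f g sg; set z := gcdp f g.
have g0 : g != 0 by rewrite -size_poly_gt0 sg.
have z0 : z != 0 by rewrite gcdp_eq0 negb_and g0 orbT.
have fE := Pdiv.Field.divpK (dvdp_gcdl f g).
have gE := Pdiv.Field.divpK (dvdp_gcdr f g).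
rewrite -/z in fE gE; set f1 := f %/ z in fE; set h := g %/ z in gE.
have h0 : h != 0 by apply: contraTneq g0 => h0; rewrite -gE h0 mul0r eqxx.
have cop : coprimep f1 h by rewrite coprimep_div_gcd // g0 orbT.
have unit_lead (p : {poly rat}) : p != 0 -> lead_coef p \is a GRing.unit.
  by rewrite unitfE lead_coef_eq0.
have szE : size z = (size z).-1.+1 by rewrite -polySpred.
have shE : size h = (size h).-1.+1 by rewrite -polySpred.
have nE : n = ((size z).-1 + (size h).-1)%N.
  by move: sg; rewrite -gE size_mul // szE shE addSn addnS /= => -[]; rewrite addnC.
have [P [Q [E [E' [defA EP QE']]]]] :=
  mulmod_mx_factor f1 (unit_lead _ z0) szE (unit_lead _ h0) shE.
rewrite -fE -gE [f1 * z]mulrC [h * z]mulrC; subst n; rewrite defA.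
rewrite (rank_factor _ EP QE').
have [[u v] uv1] := Bezout_eq1_coprimepP f1 h cop.
have := mulmod_mx_unit (unit_lead _ h0) shE uv1.
rewrite -row_free_unit => /eqP ->.
by rewrite addnK.
Qed.

Lemma monic_size2 (R : nzRingType) (p : {poly R}) : p \is monic -> size p = 2 ->
  exists a, p = 'X - a%:P.
Proof.
move=> mp sp; exists (- p`_0); apply/polyP=> -[|[|i]].
- by rewrite coefB coefX coefC sub0r opprK.
- by rewrite coefB coefX coefC subr0; move/monicP: mp; rewrite lead_coefE sp.
by rewrite coefB coefX coefC subr0 nth_default ?sp.
Qed.

Lemma realField_unity_root (F : realFieldType) (a : F) n :
  (0 < n)%N -> a ^+ n = 1 -> a = 1 \/ a = -1.
Proof.
move=> n0 /(congr1 Num.norm); rewrite normrX normr1 => /eqP.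
rewrite pexpr_eq1 // => /eqP an1.
by case: (ler0P a) an1 => _ <-; [right; rewrite opprK|left].
Qed.

(** The gcd has degree 1; its root is a rational n-th root of unity, hence 1 or -1. *)
Lemma corank1_root n (f : {poly int}) : (0 < n)%N ->
  (n - int_rank (circulant n f))%N = 1%N ->
  exists a : int, [/\ a = 1 \/ a = -1, a ^+ n = 1, f.[a] = 0
    & monic_gcd f ('X^n - 1) = 'X - (a%:~R)%:P].
Proof.
move=> n0; rewrite corank_gcd // /monic_gcd /=.
set d := gcdp _ _ => sd.
have d2 : size d = 2 by case: (size d) sd => [|[|[]]].
have ld0 : lead_coef d != 0 by rewrite lead_coef_eq0 -size_poly_gt0 d2.
have [] := @monic_size2 _ ((lead_coef d)^-1 *: d).
- by rewrite monicE lead_coefZ mulVf.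
- by rewrite size_scale // invr_eq0.
move=> a da.
have a_root p : d %| p -> root p a.
  rewrite -dvdp_XsubCl -da; apply: dvdp_trans.
  by rewrite dvdpZl ?invr_eq0.
have := a_root _ (dvdp_gcdr _ _); rewrite rmorphB rmorph1 /= map_polyXn /root.
rewrite hornerD hornerN hornerXn hornerC subr_eq0 => /eqP an1.
have := a_root _ (dvdp_gcdl _ _); rewrite /root => /eqP fa.
case: (realField_unity_root n0 an1) => a1; rewrite {}a1 in an1 fa da;
  [exists 1|exists (-1)]; split=> //.
- by left.
- by rewrite expr1n.
- by apply: (@intr_inj rat); rewrite -horner_map /= fa.
- by right.
- by apply: (@intr_inj rat); rewrite rmorphXn rmorphN /= an1.
- by apply: (@intr_inj rat); rewrite -horner_map /= rmorphN /= fa.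
Qed.

(** For d = gcd(n, nu), both [f] and t^n - 1 are polynomials in t^d vanishing at [a], so t^d - a^d
    divides their gcd, which has degree 1. *)
Lemma corank1_gcdn_nu n (f : {poly int}) : (0 < n)%N ->
  (n - int_rank (circulant n f))%N = 1%N -> gcdn n (nu f) = 1%N.
Proof.
move=> n0 rk1; have [a [_ an1 fa _]] := corank1_root n0 rk1.
set d := gcdn n (nu f); have d0 : (0 < d)%N by rewrite gcdn_gt0 n0.
have /in_ZXnP[h fE] : in_ZXn d f.
  have [sf|sf] := ltnP 1 (size f).
    have [nuf _] := nu_maxP sf.
    apply/forallP => i; apply/implyP => fi.
    by apply: dvdn_trans (dvdn_gcdr _ _) (implyP (forallP nuf i) fi).
  (* A constant [f] lies in every Z[t^d]. *)
  apply/forallP => -[[|i] li]; first by rewrite dvdn0 implybT.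
  by have := leq_trans li sf.
pose b : rat := (a ^+ d)%:~R.
have comp_XsubC : 'X^d - b%:P = ('X - b%:P) \Po 'X^d.
  by rewrite comp_polyB comp_polyX comp_polyC.
have dvd_comp (p : {poly rat}) : root p b -> 'X^d - b%:P %| p \Po 'X^d.
  case/factor_theorem=> q ->; rewrite comp_XsubC comp_polyM; exact: dvdp_mull.
have : 'X^d - b%:P %| gcdp (map_poly intr f) (map_poly intr ('X^n - 1)).
  rewrite dvdp_gcd; apply/andP; split.
    rewrite fE map_comp_poly /= map_polyXn; apply: dvd_comp.
    rewrite /root horner_map /=; move: fa.
    by rewrite fE horner_comp hornerXn => ->.
  have -> : map_poly intr ('X^n - 1) = ('X^(n %/ d) - 1) \Po 'X^d :> {poly rat}.
    rewrite rmorphB rmorph1 /= map_polyXn comp_polyB comp_Xn_poly -exprM.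
    by rewrite mulnC divnK ?dvdn_gcdl // -[1 in RHS]/(1%:P) comp_polyC.
  apply: dvd_comp; rewrite /root hornerD hornerN hornerXn hornerC subr_eq0.
  by rewrite -rmorphXn /= -exprM mulnC divnK ?dvdn_gcdl // an1.
move/dvdp_leq; rewrite -size_poly_gt0 size_XnsubC //.
move: rk1; rewrite corank_gcd //; set s := size _.
case: s => [|[|[|s]]] //= _ /(_ isT).
by rewrite ltnS => led; apply/eqP; rewrite eqn_leq led d0.
Qed.

(** * Consequences of a resultant equal to 1 *)

(** The resultant is a determinant up to sign, and here that determinant is a unit of Z. *)
Lemma Res1_bezout (p q : {poly int}) : lead_coef q \is a GRing.unit ->
  Res p q = 1%N -> exists u v, u * p + v * q = 1.
Proof.
move=> uq; rewrite absz_Res // => det1.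
apply: (@bezout_of_mulmod_mx_unit _ (size q).-1) => //.
  by rewrite -polySpred ?unit_lead_neq0.
by rewrite unitmxE unitz_absz det1.
Qed.

Lemma bezout_horner (p q u v : {poly int}) x :
  u * p + v * q = 1 -> q.[x] = 0 -> `|p.[x]|%N = 1%N.
Proof.
move=> /(congr1 (horner^~ x)); rewrite hornerD !hornerM hornerC => + q0.
rewrite q0 mulr0 addr0 => up1; apply/eqP; rewrite -unitz_absz.
by apply/unitrPr; exists u.[x]; rewrite mulrC.
Qed.

Lemma mul_XsubC_geom n : ('X - 1) * (\sum_(i < n) 'X^i) = 'X^n - 1 :> {poly int}.
Proof. by rewrite subrX1. Qed.

Lemma mul_XaddC_geom n : ~~ odd n ->
  ('X + 1) * (\sum_(i < n) (- 'X) ^+ i) = -1 *: ('X^n - 1) :> {poly int}.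
Proof.
move=> n_even; apply/eqP; rewrite scaleN1r -eqr_oppLR -mulNr opprD -subrX1.
by rewrite exprNn -signr_odd (negPf n_even) mul1r.
Qed.

Lemma unit_lead_factor n (z h : {poly int}) e : (0 < n)%N ->
  e \is a GRing.unit -> z * h = e *: ('X^n - 1) ->
  lead_coef z \is a GRing.unit /\ lead_coef h \is a GRing.unit.
Proof.
move=> n0 ue zhE; apply/andP.
by rewrite -unitrM -lead_coefM zhE lead_coefZ unitrM ue unit_lead_Xn_sub_1.
Qed.

Lemma divp_root (f : {poly int}) a : f.[a] = 0 ->
  f = ('X - a%:P) * (f %/ ('X - a%:P)).
Proof.
move/eqP; rewrite -/(root f a) => /factor_theorem[q ->].
by rewrite mulpK ?lead_coefXsubC ?unitr1 // mulrC.
Qed.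

Lemma largest_odd_divisorP n : (0 < n)%N ->
  odd (largest_odd_divisor n) /\ (largest_odd_divisor n %| n)%N.
Proof.
move=> n0; rewrite /largest_odd_divisor.
have c_gt0 : (0 < \max_(d <- divisors n | odd d) d)%N.
  rewrite (big_rem 1%N) //= ?leq_max //.
  by rewrite -dvdn_divisors ?dvd1n.
(* The empty maximum is 0, so the invariant allows 0; the odd divisor 1 excludes it. *)
suff : let c := (\max_(d <- divisors n | odd d) d)%N in
    (c == 0)%N || odd c && (c %| n)%N.
  by move=> /=; rewrite eqn0Ngt c_gt0 => /andP.
rewrite /= big_seq_cond.
apply: (big_ind (fun c => (c == 0)%N || odd c && (c %| n)%N)) => //.
  by move=> x y Px Py; rewrite /maxn; case: ifP.
by move=> d /andP[]; rewrite -dvdn_divisors // => -> ->; rewrite orbT.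
Qed.

(** The determinant is multiplicative: [f1] contributes a unit because t^c - 1 divides [h], and t +
    1 contributes, up to sign, the value -2 of t^c - 1 at -1. *)
Lemma Res_Xc_sub_1 n c (f1 h : {poly int}) :
  (0 < n)%N -> ~~ odd n -> odd c -> (c %| n)%N ->
  ('X + 1) * h = -1 *: ('X^n - 1) -> Res f1 h = 1%N ->
  Res (('X + 1) * f1) ('X^c - 1) = 2.
Proof.
move=> n0 n_even c_odd c_n hE Res1.
have c0 : (0 < c)%N by case: c c_odd {c_n}.
have [_ uh] := unit_lead_factor n0 (unitrN1 _) hE.
have mq : ('X^c - 1 : {poly int}) \is monic by apply: monicXnsubC.
have uq := unit_lead_Xn_sub_1 int c0.
have sq : size ('X^c - 1 : {poly int}) = c.+1 by rewrite size_Xn_sub_1.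
have [u [v uv1]] := Res1_bezout uh Res1.
(* As 2c divides n, t^n - 1 is a multiple of (t^c - 1)(t^c + 1), and t + 1 divides the second factor
   because c is odd. *)
have [w hw] : exists w, h = w * ('X^c - 1).
  have /dvdnP[k nE] : (c * 2 %| n)%N.
    by rewrite Gauss_dvd ?coprimen2 // c_n dvdn2.
  pose S : {poly int} := \sum_(i < c) 'X^(c.-1 - i) * (-1) ^+ i.
  have SE : ('X + 1) * S = 'X^c + 1.
    have := subrXX 'X (-1 : {poly int}) c.
    by rewrite -signr_odd c_odd expr1 !opprK => <-.
  pose K : {poly int} := \sum_(i < k) ('X^(c * 2)) ^+ i.
  exists (- (S * K)); apply: (@mulfI _ ('X + 1)).
    by rewrite -size_poly_gt0 size_XaddC.
  rewrite hE scaleN1r mulNr mulrN; congr (- _).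
  rewrite {1}nE mulnC exprM subrX1 -/K exprM -[1 in LHS](expr1n _ 2) subr_sqr.
  by rewrite -SE; ring.
rewrite absz_Res // sq /= mulrC -mulmod_mxM // det_mulmx abszM.
have -> : `|\det (mulmod_mx c f1 ('X^c - 1))|%N = 1%N.
  apply/eqP; rewrite -unitz_absz -unitmxE.
  by apply: (@mulmod_mx_unit _ _ _ _ u (v * w)) => //; rewrite -mulrA -hw.
have -> : 'X + 1 = 'X - (-1)%:P :> {poly int} by rewrite polyCN opprK.
rewrite det_mulmod_XsubC // hornerD hornerN hornerXn hornerC.
by rewrite -signr_odd c_odd.
Qed.

(** * Assembly of the three cases *)

Theorem theorem6p2 (n : nat) (hn : (1 <= n)%N) (f : {poly int})
  (rho gamma : nat) (hrho : rho = int_rank (circulant n f))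
  (hgamma : last_det_divisor (circulant n f) gamma) :
  ((n - rho)%N = 1%N /\ gamma = 1%N) <->
  (gcdn n (nu f) = 1%N /\
   [\/ (* (a) *)
       [/\ odd n, f.[1] = 0, monic_gcd f ('X^n - 1) = 'X - 1
         & Res (f %/ ('X - 1)) (\sum_(i < n) 'X^i) = 1%N],
       (* (b) *)
       [/\ ~~ odd n, f.[1] = 0, `|f.[-1]| = 2,
           monic_gcd f ('X^n - 1) = 'X - 1
         & Res (f %/ ('X - 1)) (\sum_(i < n) 'X^i) = 1%N]
     | (* (c) *)
       [/\ ~~ odd n, f.[-1] = 0, `|f.[1]| = 2,
           monic_gcd f ('X^n - 1) = 'X + 1
         & Res (f %/ ('X + 1)) (\sum_(i < n) (- 'X) ^+ i) = 1%N
           /\ Res f ('X^(largest_odd_divisor n) - 1) = 2%N]]).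
Proof.
rewrite {rho}hrho.
have XaddE : 'X - (-1)%:P = 'X + 1 :> {poly int} by rewrite polyCN opprK.
have f1E : f.[1] = 0 -> f = ('X - 1) * (f %/ ('X - 1)) by apply: divp_root.
have fN1E : f.[-1] = 0 -> f = ('X + 1) * (f %/ ('X + 1)).
  by rewrite -XaddE; apply: divp_root.
have hE1 := mul_XsubC_geom n; rewrite -[RHS]scale1r in hE1.
have main1 (f1 : f.[1] = 0) :
    ((n - int_rank (circulant n f))%N = 1%N /\ gamma = 1%N) <->
    Res (f %/ ('X - 1)) (\sum_(i < n) 'X^i) = 1%N.
  by apply: (corank1_gammaP hn (size_XsubC 1) (unitr1 _) hE1 (f1E f1) hgamma).
have mainN1 (fN1 : f.[-1] = 0) (n_even : ~~ odd n) :
    ((n - int_rank (circulant n f))%N = 1%N /\ gamma = 1%N) <->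
    Res (f %/ ('X + 1)) (\sum_(i < n) (- 'X) ^+ i) = 1%N.
  apply: (corank1_gammaP hn _ (unitrN1 _) (mul_XaddC_geom n_even) (fN1E fN1)
    hgamma).
  by rewrite -XaddE size_XsubC.
(* From right to left, each case supplies the resultant condition of the matching equivalence. *)
split=> [lhs|[_ [[_ f1 _ Res1]|[_ f1 _ _ Res1]|[n_even fN1 _ _ [Res1 _]]]]];
  [|exact/main1|exact/main1|exact/mainN1].
split; first by apply: corank1_gcdn_nu lhs.1.
(* The root 1 leads to (a) or (b) by the parity of [n], the root -1 to (c). *)
have [a [[->|->] an1 fa gcdE]] := corank1_root hn lhs.1.
  have Res1 := (main1 fa).1 lhs.
  have [n_odd|n_even] := boolP (odd n); first by constructor 1.
  constructor 2; split=> //.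
  (* For even [n], -1 is a root of the geometric sum, so f/(t - 1) is a unit there, while t - 1
     takes the value -2. *)
  have [u [v uv1]] := Res1_bezout (unit_lead_factor hn (unitr1 _) hE1).2 Res1.
  have hN1 : (\sum_(i < n) 'X^i : {poly int}).[-1] = 0.
    have /eqP := congr1 (horner^~ (-1)) hE1.
    rewrite !hornerE -signr_odd (negPf n_even) subrr.
    by rewrite mulf_eq0 => /orP[|/eqP].
  have := bezout_horner uv1 hN1.
  rewrite {2}(f1E fa) hornerM normrM !hornerE -!abszE => ->.
  by [].
have n_even : ~~ odd n by move: an1; rewrite -signr_odd; case: odd.
have Res1 := (mainN1 fa n_even).1 lhs.
have hE := mul_XaddC_geom n_even.
constructor 3; split=> //.
(* Symmetrically, 1 is a root of the alternating sum, and t + 1 takes the value 2 there. *)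
- have [u [v uv1]] := Res1_bezout (unit_lead_factor hn (unitrN1 _) hE).2 Res1.
  have h1 : (\sum_(i < n) (- 'X) ^+ i : {poly int}).[1] = 0.
    have /eqP := congr1 (horner^~ 1) hE.
    rewrite !hornerE expr1n subrr.
    by rewrite mulf_eq0 => /orP[|/eqP].
  have := bezout_horner uv1 h1.
  rewrite {2}(fN1E fa) hornerM normrM !hornerE -!abszE => ->.
  by [].
- by rewrite gcdE mulrN1z polyCN opprK.
split=> //; rewrite (fN1E fa).
have [c_odd c_n] := largest_odd_divisorP hn.
by apply: Res_Xc_sub_1 hE Res1.
Qed.
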